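(* Let $(B,\omega)$ be a well telescoped ordered Bratteli diagram with $|X_{\max}(\omega)|=|X_{\min}(\omega)|$, let $\mathcal F$ be the skeleton associated to $\omega$, and let $\sigma=(\sigma_n)_{n\ge 1}$ be the accompanying maps $\sigma_n:\widetilde V_n\to 2^{\overline V_n}$ defined by: $\overline v\in\sigma_n(\widetilde v)$ if and only if the two-letter word $\widetilde v\,\overline v$ belongs to the level-$n$ language $\mathcal L(B,\omega,n)$. Then $\omega$ is perfect if and only if $\sigma$ is a correspondence associated to $\mathcal F$.
   Context: A Bratteli diagram $B=(V,E)$ is an infinite graph with $V=\bigsqcup_{i\ge 0}V_i$, $E=\bigsqcup_{i\ge 1}E_i$, all $V_i,E_i$ finite, $V_0=\{v_0\}$, and range and source maps $r,s:E\to V$ with $r(E_i)=V_i$, $s(E_i)=V_{i-1}$, $s^{-1}(v)\ne\emptyset$ for all $v\in V$, $r^{-1}(v)\neq\emptyset$ for all $v\in V\setminus V_0$. A path is a sequence of edges with $r(e_i)=s(e_{i+1})$. $X_B$ is the space of infinite paths starting at $v_0$, with the topology generated by cylinder sets $U(e_k,\dots,e_n)=\{x: x_i=e_i,\ k\le i\le n\}$. The incidence matrix $F_n=(f^{(n)}_{v,w})_{v\in V_{n+1},w\in V_n}$, $n\ge 0$, has $f^{(n)}_{v,w}=|\{e\in E_{n+1}: r(e)=v,s(e)=w\}|$. For $x\in X_B$ and $n\ge 1$, $v_n(x)$ is the vertex of $V_n$ that $x$ passes through. An order $\omega$ on $B$ is a choice of linear order on each $r^{-1}(v)$, $v\in V\setminus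 V_0$. It induces an order on finite paths between levels $k<l$ with the same range: $(e_{k+1},\dots,e_l)>(f_{k+1},\dots,f_l)$ iff for some $i$, $e_j=f_j$ for $i<j\le l$ and $e_i>f_i$. A finite or infinite path is maximal (minimal) if each of its edges $e_i$ is maximal (minimal) in $r^{-1}(r(e_i))$. $X_{\max}(\omega),X_{\min}(\omega)$ are the sets of maximal and minimal infinite paths in $X_B$. For $v\in V\setminus V_0$, $\widetilde e_v$ and $\overline e_v$ denote the maximal and minimal edges in $r^{-1}(v)$. Standing assumptions: $X_B$ has no isolated points; $B$ is aperiodic (every class of the tail equivalence relation on $X_B$, where $x\sim y$ iff $x_n=y_n$ for all large $n$, is infinite); $B$ is regular (for every order $\omega$ on $B$, $X_{\max}(\omega)$ and $X_{\min}(\omega)$ have empty interior). A Vershik map for $\omega$ is a homeomorphism $\varphi_\omega:X_B\to X_B$ with $\varphi_\omega(X_{\max}(\omega))=X_{\min}(\omega)$ and, for $x\notin X_{\max}(\omega)$, $\varphi_\omega(x)=(x_1^0,\dots,x_{k-1}^0,\overline{x_k},x_{k+1},\dots)$, where $k$ is least with $x_k$ not maximal, $\overline{x_k}$ is the successor of $x_k$ in $r^{-1}(r(x_k))$ and $(x_1^0,\dots,x_{k-1}^0)$ is the minimal path from $v_0$ to $s(\overline{x_k})$. The order $\omega$ is perfect if it admits a Vershik map. Language: for $v\in V_N$ and $n<N$, list all paths from $V_n$ to $v$ in increasing order as $e_1<\dots<e_p$ and set $w(v,n,N)=s(e_1)\cdots s(e_p)\in V_n^+$. $\mathcal L(B,\omega,n)$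 is the set of all subwords of words $w(v,n,N)$, $v\in V_N$, $N>n$. Maximal and minimal vertices: $\widetilde V_n=\{v_n(M):M\in X_{\max}(\omega)\}$, $\overline V_n=\{v_n(m):m\in X_{\min}(\omega)\}$. $(B,\omega)$ is well telescoped if for each $n\ge 1$ and $v\in V_{n+1}$, $s(\widetilde e_v)\in\widetilde V_n$ and $s(\overline e_v)\in\overline V_n$, and all nonzero incidence matrix entries are at least two. The skeleton $\mathcal F$ associated to such an $\omega$ (with $|X_{\max}(\omega)|=|X_{\min}(\omega)|$) consists of the sets $\widetilde V_n,\overline V_n$ and the edges $\widetilde e_v,\overline e_v$; one puts $X_{\max}(\mathcal F)=X_{\max}(\omega)$ and $X_{\min}(\mathcal F)=X_{\min}(\omega)$. A sequence $\sigma=(\sigma_n)_{n\ge1}$ of maps $\sigma_n:\widetilde V_n\to 2^{\overline V_n}$ with $\bigcup_{\widetilde v\in\widetilde V_n}\sigma_n(\widetilde v)=\overline V_n$ for each $n$ is a correspondence associated to $\mathcal F$ if, writing $\sigma_n^{-1}(\overline v)=\{\widetilde v:\overline v\in\sigma_n(\widetilde v)\}$: (1) (composition consistency) for $n<N$, if $M(n,N,\widetilde v)$ and $m(n,N,\overline v)$ denote the maximal and minimal paths from level $n$ to level $N$ with range $\widetilde v$ and $\overline v$ respectively (those with edges $\widetilde e_\cdot$, resp. $\overline e_\cdot$), then $\overline v\in\sigma_N(\widetilde v)$ implies $s(m(n,N,\overline v))\in\sigma_n(s(M(n,N,\widetilde v)))$; (2) for every $M\in X_{\max}(\mathcal F)$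 there is a unique $m\in X_{\min}(\mathcal F)$ with $v_n(m)\in\sigma_n(v_n(M))$ for all $n$; (3) for every $m\in X_{\min}(\mathcal F)$ there is a unique $M\in X_{\max}(\mathcal F)$ with $v_n(M)\in\sigma_n^{-1}(v_n(m))$ for all $n$; (4) the bijection $\sigma:X_{\max}(\mathcal F)\to X_{\min}(\mathcal F)$ determined by (2) and (3) is a homeomorphism. *)

(* Defs.v *)
From HB Require Import structures.
From mathcomp Require Import all_boot.
From mathcomp Require Import all_classical all_reals all_analysis.

Set Implicit Arguments.
Unset Strict Implicit.
Unset Printing Implicit Defensive.

Local Open Scope classical_set_scope.

Definition homeomorphism (T U : topologicalType) (f : T -> U) : Prop :=
  continuous f /\
  exists g : U -> T, [/\ continuous g, cancel f g & cancel g f].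

(* [edge n] is the set usually written E_(n+1): its elements go from level n
   to level n+1.  Infinite paths are accordingly numbered from 0. *)
Record bratteli := Bratteli {
  vert : nat -> finType;
  edge : nat -> finType;
  src : forall n, edge n -> vert n;
  rng : forall n, edge n -> vert n.+1;
  root : vert 0;
  root_unique : forall v : vert 0, v = root;
  src_surj : forall n (v : vert n), exists e : edge n, src e == v;
  rng_surj : forall n (v : vert n.+1), exists e : edge n, rng e == v
}.

Arguments src {b n} _.
Arguments rng {b n} _.

Definition incidence (B : bratteli) n (v : vert B n.+1) (w : vert B n) : nat :=
  #|[set e : edge B n | (rng e == v) && (src e == w)]%SET|.

(** Finite paths: [edge_seq B n m] consists of m+1 edges, from level n to level
    (m + n).+1; as m varies, the latter ranges over all levels N > n. *)

Definition edge_seq (B : bratteli) n m :=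
  {dffun forall i : 'I_m.+1, edge B (i + n)}.

Definition is_path (B : bratteli) n m (p : edge_seq B n m) : bool :=
  [forall i : 'I_m, rng (p (widen_ord (leqnSn m) i)) == src (p (lift ord0 i))].

Definition path_src (B : bratteli) n m (p : edge_seq B n m) : vert B n :=
  src (p ord0).

Definition path_rng (B : bratteli) n m (p : edge_seq B n m) :
  vert B (m + n).+1 := rng (p ord_max).

Definition paths_to (B : bratteli) n m (v : vert B (m + n).+1) :
  {set edge_seq B n m} := [set p | is_path p && (path_rng p == v)]%SET.

(** The path space.  Its elements start at the root since level 0 is {root}. *)

Record path_space (B : bratteli) := PathSpace {
  edge_at :> forall n, edge B n;
  edge_at_path : forall n, rng (edge_at n) = src (edge_at n.+1)
}.

HB.instance Definition _ (B : bratteli) := gen_eqMixin (path_space B).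
HB.instance Definition _ (B : bratteli) := gen_choiceMixin (path_space B).

Definition cylinder (B : bratteli) n m (p : edge_seq B n m) :
  set (path_space B) := [set x | forall i : 'I_m.+1, x (i + n) = p i].

Definition cylinders (B : bratteli) : set (set (path_space B)) :=
  [set U | exists n m (p : edge_seq B n m), is_path p /\ U = cylinder p].

HB.instance Definition _ (B : bratteli) :=
  isSubBaseTopological.Build (path_space B) (@cylinders B) id.

Definition vtx (B : bratteli) n (x : path_space B) : vert B n := src (x n).

(** Orders: two edges are comparable iff they have the same range, so that this
    is a linear order on each fibre of the range map. *)

Record border (B : bratteli) := BOrder {
  ole : forall n, rel (edge B n);
  ole_refl : forall n, reflexive (@ole n);
  ole_anti : forall n, antisymmetric (@ole n);
  ole_trans : forall n, transitive (@ole n);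
  ole_comparable : forall n (e f : edge B n),
    (ole e f || ole f e) = (rng e == rng f)
}.

Section Order.
Variables (B : bratteli) (w : border B).

Definition olt n (e f : edge B n) : bool := (e != f) && ole w e f.

Definition maximal_edge n (e : edge B n) : bool :=
  [forall f : edge B n, (rng f == rng e) ==> ole w f e].

Definition minimal_edge n (e : edge B n) : bool :=
  [forall f : edge B n, (rng f == rng e) ==> ole w e f].

Lemma fibre_extremum n (le : rel (edge B n)) (v : vert B n.+1) :
    reflexive le -> transitive le ->
    (forall e f, (le e f || le f e) = (rng e == rng f)) ->
  exists e : edge B n,
    (rng e == v) && [forall f : edge B n, (rng f == rng e) ==> le f e].
Proof.
move=> le_refl le_trans le_cmp; have [e0 e0v] := rng_surj v.
pose P := [pred e : edge B n | rng e == v].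
suff [e ev eM] : exists2 e, P e & forall f, f \in enum P -> le f e.
  exists e; rewrite [_ == _]ev; apply/forallP => f; apply/implyP => /eqP fe.
  by apply: eM; rewrite mem_enum inE fe.
have : all P (enum P) by apply/allP => f; rewrite mem_enum.
elim: (enum P) => [_|f s IHs /= /andP[fv /IHs [e ev eM]]]; first by exists e0.
have := le_cmp e f; rewrite (eqP ev) (eqP fv) eqxx => /orP[ef|fe].
  exists f => // g; rewrite inE => /predU1P[->//|/eM ge].
  exact: le_trans ef.
by exists e => // g; rewrite inE => /predU1P[->//|/eM].
Qed.

Lemma max_edge_exists n (v : vert B n.+1) :
  exists e : edge B n, (rng e == v) && maximal_edge e.
Proof.
exact: (fibre_extremum _ (ole_refl w (n := n)) (@ole_trans _ w n)
  (@ole_comparable _ w n)).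
Qed.

Lemma min_edge_exists n (v : vert B n.+1) :
  exists e : edge B n, (rng e == v) && minimal_edge e.
Proof.
apply: (@fibre_extremum n (fun e f => ole w f e) v).
- exact: ole_refl.
- by move=> f e g ef fg; exact: ole_trans fg ef.
- by move=> e f; rewrite orbC ole_comparable.
Qed.

Definition max_edge n (v : vert B n.+1) : edge B n := xchoose (max_edge_exists v).
Definition min_edge n (v : vert B n.+1) : edge B n := xchoose (min_edge_exists v).

Definition Xmax : set (path_space B) := [set x | forall n, maximal_edge (x n)].
Definition Xmin : set (path_space B) := [set x | forall n, minimal_edge (x n)].

Definition Vmax n : set (vert B n) := [set vtx n x | x in Xmax].
Definition Vmin n : set (vert B n) := [set vtx n x | x in Xmin].

Definition is_succ n (e f : edge B n) : Prop :=
  olt e f /\ forall g : edge B n, olt e g -> ole w f g.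

(* The first k edges of [phi x] form the minimal path from the root to the
   source of [phi x k] because [phi x] is a path. *)
Definition vershik_map (phi : path_space B -> path_space B) : Prop :=
  [/\ homeomorphism phi, phi @` Xmax = Xmin &
      forall (x : path_space B) (k : nat),
        ~~ maximal_edge (x k) -> (forall i, i < k -> maximal_edge (x i)) ->
        [/\ forall i, i < k -> minimal_edge (phi x i),
            is_succ (x k) (phi x k) &
            forall i, k < i -> phi x i = x i]].

Definition perfect_order : Prop := exists phi, vershik_map phi.

Definition path_lt n m (p q : edge_seq B n m) : bool :=
  [exists i : 'I_m.+1, olt (p i) (q i) &&
    [forall j : 'I_m.+1, (i < j) ==> (p j == q j)]].

Definition path_le n m (p q : edge_seq B n m) : bool := (p == q) || path_lt p q.

Definition word n m (v : vert B (m + n).+1) : seq (vert B n) :=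
  [seq path_src p | p <- sort (@path_le n m) (enum (paths_to v))].

Definition language n : set (seq (vert B n)) :=
  [set u | exists m (v : vert B (m + n).+1), infix u (word v)].

Definition well_telescoped : Prop :=
  [/\ forall n (v : vert B n.+1), 0 < n -> Vmax (src (max_edge v)),
      forall n (v : vert B n.+1), 0 < n -> Vmin (src (min_edge v)) &
      forall n (v : vert B n.+1) (u : vert B n),
        incidence v u != 0 -> 2 <= incidence v u].

(* Only the values at 0 < n and v in [Vmax n] are meaningful. *)
Definition language_maps n (v : vert B n) : set (vert B n) :=
  [set u | Vmin u /\ language [:: v; u]].

End Order.

(** Standing assumptions *)

Definition no_isolated_point (B : bratteli) : Prop :=
  isolated [set: path_space B] = set0.

Definition tail_equiv (B : bratteli) (x y : path_space B) : Prop :=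
  exists N, forall n, N <= n -> x n = y n.

Definition aperiodic (B : bratteli) : Prop :=
  forall x : path_space B, infinite_set [set y | tail_equiv x y].

Definition regular_diagram (B : bratteli) : Prop :=
  forall w : border B, interior (Xmax w) = set0 /\ interior (Xmin w) = set0.

(** Skeletons and correspondences *)

Record skeleton (B : bratteli) := Skeleton {
  sk_Vmax : forall n, set (vert B n);
  sk_Vmin : forall n, set (vert B n);
  sk_max_edge : forall n, vert B n.+1 -> edge B n;
  sk_min_edge : forall n, vert B n.+1 -> edge B n
}.

Definition skeleton_of (B : bratteli) (w : border B) : skeleton B :=
  Skeleton (Vmax w) (Vmin w) (@max_edge B w) (@min_edge B w).

Section Correspondence.
Variables (B : bratteli) (F : skeleton B).

Definition sk_Xmax : set (path_space B) :=
  [set x | forall n, x n = sk_max_edge F (rng (x n))].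
Definition sk_Xmin : set (path_space B) :=
  [set x | forall n, x n = sk_min_edge F (rng (x n))].

Definition sk_max_path n m (p : edge_seq B n m) : Prop :=
  is_path p /\ forall i, p i = sk_max_edge F (rng (p i)).
Definition sk_min_path n m (p : edge_seq B n m) : Prop :=
  is_path p /\ forall i, p i = sk_min_edge F (rng (p i)).

Variable sigma : forall n, vert B n -> set (vert B n).

Definition composition_consistent : Prop :=
  forall n m (p q : edge_seq B n m), 0 < n ->
    sk_max_path p -> sk_Vmax F (path_rng p) ->
    sk_min_path q -> sk_Vmin F (path_rng q) ->
    sigma (path_rng p) (path_rng q) -> sigma (path_src p) (path_src q).

Definition sigma_related (M m : path_space B) : Prop :=
  forall n, 0 < n -> sigma (vtx n M) (vtx n m).

Definition correspondence : Prop :=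
  [/\ forall n, 0 < n ->
        \bigcup_(v in @sk_Vmax B F n) sigma v = @sk_Vmin B F n,
      composition_consistent,
      forall M, sk_Xmax M -> exists! m, sk_Xmin m /\ sigma_related M m,
      forall m, sk_Xmin m -> exists! M, sk_Xmax M /\ sigma_related M m &
      exists2 f : sk_Xmax -> sk_Xmin,
        forall M, sigma_related (set_val M) (set_val (f M)) & homeomorphism f].

End Correspondence.

Lemma max_edgeP (B : bratteli) (w : border B) n (e : edge B n) :
  maximal_edge w e <-> e = max_edge w (rng e).
Proof.
have /andP[/eqP rM /forallP M] := xchooseP (max_edge_exists w (rng e)).
split=> [/forallP me|->]; last by apply/forallP.
apply: (@ole_anti _ w); rewrite (implyP (M e)) ?rM ?eqxx//=.
by rewrite (implyP (me _)) ?rM.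
Qed.

Lemma min_edgeP (B : bratteli) (w : border B) n (e : edge B n) :
  minimal_edge w e <-> e = min_edge w (rng e).
Proof.
have /andP[/eqP rM /forallP M] := xchooseP (min_edge_exists w (rng e)).
split=> [/forallP me|->]; last by apply/forallP.
apply: (@ole_anti _ w); rewrite (implyP (M e)) ?rM ?eqxx//=.
by rewrite (implyP (me _)) ?rM.
Qed.

Lemma sk_Xmax_skeleton_of (B : bratteli) (w : border B) :
  sk_Xmax (skeleton_of w) = Xmax w.
Proof. by apply/seteqP; split=> x xM n; apply/max_edgeP/xM. Qed.

Lemma sk_Xmin_skeleton_of (B : bratteli) (w : border B) :
  sk_Xmin (skeleton_of w) = Xmin w.
Proof. by apply/seteqP; split=> x xM n; apply/min_edgeP/xM. Qed.

(* Main.v *)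
Require Import Defs.
From mathcomp Require Import all_boot finmap.
From mathcomp Require Import all_classical all_reals all_analysis.

(* If phi is a Vershik map, regularity makes every maximal path M a limit of
   non-maximal paths x; as x and phi x are consecutive, all the words
   v_n(M) v_n(phi M) belong to the language.  Conversely, a word v_n(M) v_n(m) of
   the language comes from consecutive paths that agree with M and m up to level
   n, so if this holds for all n then phi M = m by continuity.  Hence the language
   maps form a correspondence, with phi as the bijection of (4).
   In the other direction, the bijection given by (2) and (3) together with the
   successor map is a bijective relation on the path space.  It is closed, by
   uniqueness in (2), and the path space is compact, so the relation is the graph
   of a homeomorphism. *)

Set Implicit Arguments.
Unset Strict Implicit.
Unset Printing Implicit Defensive.

Local Open Scope classical_set_scope.
Local Open Scope card_scope.

(** * Topology and compactness of the path space *)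

Section PathSpace.
Variable B : bratteli.
Implicit Types x y z : path_space B.

Lemma path_ext x y : (forall i, x i = y i) -> x = y.
Proof.
case: x y => [x xP] [y yP] /= xy.
have exy : x = y by apply: functional_extensionality_dep.
by rewrite exy in xP *; congr PathSpace; apply: Prop_irrelevance.
Qed.

Definition agree N x y := forall i, i < N -> x i = y i.

Lemma agree_le N M x y : M <= N -> agree N x y -> agree M x y.
Proof. by move=> MN xy i iM; apply: xy; apply: leq_trans MN. Qed.

Lemma agree_sym N x y : agree N x y -> agree N y x.
Proof. by move=> xy i iN; rewrite xy. Qed.

(** A cylinder constrains finitely many edges, and so does a finite intersection of cylinders;
    conversely, prescribing a single edge is a cylinder over a one-edge path. Openness and limits
    are thus expressed by agreement of initial segments. *)
Lemma nbhs_pathP x (A : set (path_space B)) :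
  nbhs x A <-> exists N, forall y, agree N x y -> A y.
Proof.
split=> [|[N NA]]; last first.
  suff near_eq : forall i, nbhs x [set y : path_space B | x i = y i].
    have : nbhs x [set y : path_space B | forall i : 'I_N, x i = y i].
      exact: (filter_forall (F := nbhs x)
        (f := fun (i : 'I_N) y => x i = y i) _ near_eq).
    by apply: filterS => y xy; apply: NA => i iN; apply: (xy (Ordinal iN)).
  move=> i; pose p : edge_seq B i 0 := [ffun j : 'I_1 => x (j + i)].
  have -> : [set y : path_space B | x i = y i] = cylinder p.
    apply/seteqP; split=> y /=.
      by move=> xy j; rewrite /p ffunE (ord1 j).
    by move=> /(_ ord0); rewrite /p ffunE.
  apply: open_nbhs_nbhs; split; last by move=> j; rewrite ffunE.
  exists [set cylinder p]; last by rewrite bigcup_set1.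
  move=> _ ->; exists [fset cylinder p]%fset; last first.
    by rewrite set_fset1 bigcap_set1.
  move=> _ /[!inE] ->; exists i, 0, p; split=> //.
  by apply/forallP; case.
rewrite nbhsE => -[U [[D DI <-] [V DV Vx]] UA].
have [F FC VF] := DI _ DV.
suff [N NV] : exists N, forall y, agree N x y -> V y.
  by exists N => y /NV Vy; apply: UA; exists V.
rewrite -{}VF in Vx *.
have {}FC C : C \in F -> exists N, forall y, agree N x y -> C y.
  move=> CF; have := Vx _ CF; have /set_mem[n [m [p [_ ->]]]] := FC _ CF.
  move=> xC; exists (m + n).+1 => y xy i; rewrite -xy ?xC//.
  by rewrite ltnS leq_add2r -ltnS.
have : forall s : seq (set (path_space B)), {subset s <= F} ->
    exists N, forall y, agree N x y -> forall C, C \in s -> C y.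
  elim=> [|C s IHs] sF; first by exists 0.
  have [N NC] := FC C (sF _ (mem_head _ _)).
  have [E Es|M Ms] := IHs; first by apply: sF; rewrite in_cons Es orbT.
  exists (maxn N M) => y xy E /predU1P[->|].
    by apply/NC/agree_le/xy/leq_maxl.
  by apply: Ms; apply/agree_le/xy/leq_maxr.
move=> /(_ F) [//|N NF]; exists N => y /NF yF C CF; exact: yF.
Qed.

(* The ultrafilter on the indices stands for compactness of the path space. *)
Lemma closed_graph_continuous (R : path_space B -> path_space B -> Prop)
    (phi : path_space B -> path_space B) :
  (forall x, R x (phi x)) ->
  (forall x y y', R x y -> R x y' -> y = y') ->
  (forall x y, (forall N, exists x' y',
     [/\ R x' y', agree N x x' & agree N y y']) -> R x y) ->
  continuous phi.
Proof.
move=> Rphi Rfun Rclosed x A /nbhs_pathP[n nA].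
apply/nbhs_pathP; apply: contrapT => noN.
have {noN} /choice[u uP] : forall N, exists x',
    agree N x x' /\ ~ agree n (phi x) (phi x').
  move=> N; apply: contrapT => none; apply: noN; exists N => y xy.
  by apply: nA; apply: contrapT => ny; apply: none; exists y.
have [U [ultraU ooU]] := @ultraFilterLemma nat \oo _.
(* The edge set at each level is finite, so along the ultrafilter the [i]-th edge of [phi (u N)] is
   constant. These edges form the limit path [y]. *)
have pigeonhole i : exists e : edge B i, U [set N | phi (u N) i = e].
  apply: contrapT => none.
  have : U [set N | forall e : edge B i, phi (u N) i <> e].
    apply: (filter_forall (F := U) (f := fun e N => phi (u N) i <> e)) => e.
    have [Ue|//] := in_ultra_setVsetC [set N | phi (u N) i = e] ultraU.
    by case: none; exists e.
  by move=> /filter_ex[N /(_ (phi (u N) i))]; apply.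
pose e i := projT1 (cid (pigeonhole i)).
have eP i : U [set N | phi (u N) i = e i] := projT2 (cid (pigeonhole i)).
have y_path i : rng (e i) = src (e i.+1).
  have : U ([set N | phi (u N) i = e i] `&`
            [set N | phi (u N) i.+1 = e i.+1]) by exact: filterI.
  by move=> /filter_ex[N [/= <- <-]]; apply: edge_at_path.
pose y := PathSpace y_path.
have near_y N : U [set M | N <= M /\ agree N y (phi (u M))].
  apply: filterI; first by apply: ooU; exact: nbhs_infty_ge.
  have : U [set M | forall i : 'I_N, phi (u M) i = e i].
    exact: (filter_forall (F := U) (f := fun (i : 'I_N) M => phi (u M) i = e i)
      _ (fun i => eP i)).
  by apply: filterS => M uM i iN; rewrite (uM (Ordinal iN)).
(* Closedness puts the limit pair in [R], so [y] is [phi x], although every [phi (u M)] differs from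
   [phi x] before index [n]. *)
have Rxy : R x y.
  apply: Rclosed => N; have /filter_ex[M [NM yM]] := near_y N.
  by exists (u M), (phi (u M)); split=> //; apply: agree_le NM (uP M).1.
have /filter_ex[M [_ yM]] := near_y n.
by apply: (uP M).2; rewrite -(Rfun _ _ _ Rxy (Rphi x)).
Qed.

End PathSpace.

(** * Splicing of paths and reversal of the order *)

Lemma splice (B : bratteli) n (x y : path_space B) : vtx n x = vtx n y ->
  exists z : path_space B,
    (forall i, i < n -> z i = x i) /\ (forall i, n <= i -> z i = y i).
Proof.
move=> xy; pose f i := if i < n then x i else y i.
have fP i : rng (f i) = src (f i.+1).
  rewrite /f; case: (ltnP i.+1 n) => [in1|].
    by rewrite ltnW ?edge_at_path.
  rewrite leq_eqVlt => /predU1P[ni|]; last first.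
    by rewrite ltnS => /leq_gtF ->; rewrite edge_at_path.
  by rewrite ni ltnSn edge_at_path -[src _]/(vtx _ _) -ni.
exists (PathSpace fP); split=> i /=; rewrite /f; first by move=> ->.
by move=> /leq_gtF ->.
Qed.

(** Reversal exchanges maximal and minimal edges, so statements about predecessors follow from those
    about successors. *)
Definition rev_border (B : bratteli) (w : border B) : border B.
Proof.
apply: (@BOrder B (fun n e f => ole w f e)) => n.
- exact: ole_refl.
- by move=> e f /andP[fe ef]; apply: (@ole_anti _ w); rewrite ef.
- by move=> e f g ef fg; apply: ole_trans fg ef.
- by move=> e f; rewrite orbC ole_comparable.
Defined.

(** * Successors within a fibre of the range map *)

Section Edges.
Variables (B : bratteli) (w : border B) (n : nat).
Implicit Types e f g : edge B n.

Lemma olt_rng e f : olt w e f -> rng e = rng f.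
Proof. by move=> /andP[_ ef]; apply/eqP; rewrite -(ole_comparable w) ef. Qed.

Lemma oltNge e f : rng e = rng f -> olt w e f = ~~ ole w f e.
Proof.
move=> /eqP ef; rewrite -(ole_comparable w) in ef; apply/idP/idP.
  move=> /andP[neq lef]; apply: contra neq => lfe.
  by apply/eqP/(@ole_anti _ w); rewrite lef.
move=> nfe; move: ef; rewrite (negPf nfe) orbF /olt => ->; rewrite andbT.
by apply: contra nfe => /eqP ->; apply: ole_refl.
Qed.

Lemma olt_trans e f g : olt w e f -> olt w f g -> olt w e g.
Proof.
move=> ef fg; have rfg := olt_rng fg; have ref := olt_rng ef.
rewrite oltNge ?ref//; apply/negP => ge; move: fg.
rewrite oltNge// => /negP; apply.
by apply: ole_trans ge _; case/andP: ef.
Qed.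

Lemma maximal_olt e f : maximal_edge w e -> olt w e f = false.
Proof.
move=> /forallP/(_ f)/implyP eM; apply/negP => ef.
by move: (ef); rewrite oltNge ?(olt_rng ef)// eM ?(olt_rng ef).
Qed.

Lemma minimal_olt e f : minimal_edge w f -> olt w e f = false.
Proof.
move=> /forallP/(_ e)/implyP fm; apply/negP => ef.
by move: (ef); rewrite oltNge ?(olt_rng ef)// fm ?(olt_rng ef).
Qed.

Lemma nonmaximal_olt e : ~~ maximal_edge w e -> exists f, olt w e f.
Proof.
move=> /forallPn[f]; rewrite negb_imply => /andP[/eqP fe Nfe].
by exists f; rewrite oltNge.
Qed.

Lemma nonminimal_olt e : ~~ minimal_edge w e -> exists f, olt w f e.
Proof.
move=> /forallPn[f]; rewrite negb_imply => /andP[/eqP fe Nfe].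
by exists f; rewrite oltNge.
Qed.

Lemma is_succ_exists e : ~~ maximal_edge w e -> exists f, is_succ w e f.
Proof.
move=> /nonmaximal_olt[f0 ef0].
(* The successor is the edge above [e] that has the most edges above it: an edge strictly between
   would have more. *)
case: (arg_maxnP (fun f => #|[set g | olt w f g]%SET|) ef0) => f ef fmax.
exists f; split=> // g eg; apply: contraT.
rewrite -oltNge => [gf|]; last by rewrite -(olt_rng ef) (olt_rng eg).
have := fmax g eg; rewrite /= leqNgt => /negP[]; apply: proper_card.
apply/properP; split.
  by apply/fintype.subsetP => h; rewrite !inE; apply: olt_trans.
by exists f; rewrite ?inE// /olt eqxx.
Qed.

Lemma is_succ_unique e f g : is_succ w e f -> is_succ w e g -> f = g.
Proof.
by move=> [ef fP] [eg gP]; apply: (@ole_anti _ w); rewrite fP ?gP.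
Qed.

Lemma is_succ_nonmaximal e f : is_succ w e f -> ~~ maximal_edge w e.
Proof. by move=> [ef _]; apply/negP => /(maximal_olt f); rewrite ef. Qed.

Lemma is_succ_rev e f : is_succ w e f -> is_succ (rev_border w) f e.
Proof.
have rev g h : olt (rev_border w) g h = olt w h g by rewrite /olt eq_sym.
move=> [ef fP]; split=> [|g]; rewrite rev // => gf.
apply: contraT => /= Nge; move: (gf); rewrite oltNge ?(olt_rng gf)// fP//.
by rewrite oltNge// (olt_rng gf) (olt_rng ef).
Qed.

Lemma min_edge_min (v : vert B n.+1) :
  rng (min_edge w v) = v /\ minimal_edge w (min_edge w v).
Proof. by have /andP[/eqP] := xchooseP (min_edge_exists w (n := n) v). Qed.

End Edges.

(** * Successors of infinite paths *)

Section Paths.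
Variables (B : bratteli) (w : border B).
Implicit Types x y z : path_space B.

(** The result is only a family of edges, since [b] need not continue [e] to a path. This serves
    both to modify an infinite path and to extend a finite one. *)
Lemma minimal_below (b : forall i, edge B i) k (e : edge B k) :
  exists y : forall i, edge B i,
    [/\ y k = e,
        forall i, i < k -> rng (y i) = src (y i.+1) /\ minimal_edge w (y i) &
        forall i, k < i -> y i = b i].
Proof.
elim: k e b => [|k IHk] e b.
  exists (dfwith b 0 e); split=> [|//|i i0];
    by rewrite ?dfwithin ?dfwithout// ltn_eqF.
have [r m] := min_edge_min w (src e).
(* Storing [e] in the tail at index [k.+1] lets the induction descend to the minimal edge into its
   source. *)
have [y [yk yP yb]] := IHk (min_edge w (src e)) (dfwith b k.+1 e).
have yk1 : y k.+1 = e by rewrite yb// dfwithin.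
exists y; split=> // i => [|ki].
  by rewrite ltnS leq_eqVlt => /predU1P[->|/yP//]; rewrite yk1 yk.
by rewrite yb ?dfwithout ?ltn_eqF// ltnW.
Qed.

Lemma replace_edge x k (e : edge B k) : rng e = rng (x k) ->
  exists y, [/\ y k = e, forall i, i < k -> minimal_edge w (y i) &
                forall i, k < i -> y i = x i].
Proof.
move=> ex; have [y [yk yP yx]] := minimal_below x e.
have y_path i : rng (y i) = src (y i.+1).
  case: (ltngtP i k) => [/yP[]//|ki|->]; last first.
    by rewrite yk yx// ex edge_at_path.
  by rewrite !yx ?edge_at_path// ltnW.
by exists (PathSpace y_path); split=> // i /yP[].
Qed.

(** Going down from level [k], the common vertex determines the minimal edge into it, and so the
    next common vertex. *)
Lemma minimal_unique n k x y :
  (forall i, n <= i < k -> minimal_edge w (x i) /\ minimal_edge w (y i)) ->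
  vtx k x = vtx k y -> forall i, n <= i < k -> x i = y i.
Proof.
move=> xym xyk.
have step i : n <= i < k -> vtx i.+1 x = vtx i.+1 y -> x i = y i.
  move=> /xym[/min_edgeP xi /min_edgeP yi] xy.
  by rewrite xi yi !edge_at_path; congr min_edge.
suff xyd d i : n <= i -> i + d = k -> vtx i x = vtx i y.
  move=> i /andP[ni ik]; apply: step; first by rewrite ni.
  by apply: (xyd (k - i.+1)); rewrite ?subnKC// ltnW.
elim: d i => [|d IHd] i ni idk; first by rewrite addn0 in idk; rewrite idk.
rewrite /vtx step//; first by rewrite ni -idk addnS ltnS leq_addr.
by apply: IHd; [rewrite ltnW|rewrite addSnnS].
Qed.

(* [y] is the successor of [x] among the paths that start at level [n]. *)
Definition succ_from n k x y :=
  [/\ n <= k,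
      forall i, n <= i < k -> maximal_edge w (x i) /\ minimal_edge w (y i),
      is_succ w (x k) (y k) &
      forall i, k < i -> y i = x i].

Lemma succ_from_le n n' k x y : n <= n' <= k ->
  succ_from n k x y -> succ_from n' k x y.
Proof.
move=> /andP[nn' n'k] [_ xy s e]; split=> // i /andP[n'i ik].
by apply: xy; rewrite ik (leq_trans nn').
Qed.

Lemma succ_from_exists x : ~ Xmax w x -> exists k y, succ_from 0 k x y.
Proof.
move=> xNM; have exk : exists k, ~~ maximal_edge w (x k).
  apply: contrapT => none; apply: xNM => k; apply: contraT => ?.
  by case: none; exists k.
case: (ex_minnP exk) => k xk kmin.
have [f xf] := is_succ_exists xk.
have [|y [yk ym yx]] := @replace_edge x k f; first by case: xf => /olt_rng.
exists k, y; split=> //; last by rewrite yk.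
move=> i /= ik; split; last exact: ym.
by apply: contraT => /kmin; rewrite leqNgt ik.
Qed.

Lemma succ_from_nonmax n k x y : succ_from n k x y -> ~ Xmax w x.
Proof. by move=> [_ _ /is_succ_nonmaximal xk _] /(_ k); apply/negP. Qed.

(** The edge [x k] is not maximal, so a maximal path cannot share it. *)
Lemma succ_from_agree_max n k N x x' y : succ_from n k x y ->
  Xmax w x' -> agree N x x' -> N <= k.
Proof.
move=> [_ _ /is_succ_nonmaximal xk _] x'M xx'; rewrite leqNgt; apply: contra xk.
by move=> kN; rewrite xx'.
Qed.

(** The index of the first non-maximal edge can be read off the first [k.+1] edges. *)
Lemma succ_from_first k k' x x' y y' : succ_from 0 k x y ->
  succ_from 0 k' x' y' -> agree k.+1 x x' -> k' = k.
Proof.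
move=> [_ xy xk _] [_ x'y' x'k _] xx'.
move: (is_succ_nonmaximal xk) (is_succ_nonmaximal x'k) => {}xk {}x'k.
case: (ltngtP k' k) => // kk'.
  by case/negP: x'k; rewrite -(xx' k' (leqW kk')); apply: (xy _ kk').1.
by case/negP: xk; rewrite (xx' k (ltnSn k)); apply: (x'y' _ kk').1.
Qed.

(** This is continuity of the successor map off the maximal paths: the edges of [x] up to [k]
    determine [y k], its source determines the minimal edges below, and above [k] the path [y]
    copies [x]. *)
Lemma succ_from_agree k k' N x x' y y' : succ_from 0 k x y ->
  succ_from 0 k' x' y' -> k < N -> agree N x x' -> agree N y y'.
Proof.
move=> xy x'y' kN xx'.
have kk' : k' = k by apply: succ_from_first xy x'y' _; apply: agree_le xx'.
rewrite {k'}kk' in x'y'; move: xy x'y' => [_ xy sxy exy] [_ x'y' sx'y' ex'y'].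
have yk : y k = y' k by apply: is_succ_unique sxy _; rewrite xx'.
move=> i iN; case: (ltngtP i k) => [ik|ki|->//].
  apply: (minimal_unique (n := 0) (k := k)) => // [j jk|].
    by split; [apply: (xy _ jk).2|apply: (x'y' _ jk).2].
  by rewrite /vtx yk.
by rewrite exy// ex'y'// xx'.
Qed.

Lemma succ_from_unique k k' x y y' :
  succ_from 0 k x y -> succ_from 0 k' x y' -> y = y'.
Proof.
move=> xy xy'; apply: path_ext => i.
by apply: (succ_from_agree (N := (maxn i k).+1) xy xy') => //;
  rewrite ltnS ?leq_maxl ?leq_maxr.
Qed.

(** Whether two paths are consecutive from level [n] does not depend on their edges below [n], so
    these can be replaced by those of [a] and [b]. The pair remains consecutive from every lower
    level down to which [a] is maximal and [b] minimal. *)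
Lemma succ_from_lower n k x y a b : succ_from n k x y ->
  vtx n a = vtx n x -> vtx n b = vtx n y ->
  exists x' y', [/\ agree n a x', agree n b y' &
    forall n', n' <= n ->
      (forall i, n' <= i < n -> maximal_edge w (a i) /\ minimal_edge w (b i)) ->
      succ_from n' k x' y'].
Proof.
move=> [nk xy s e] eax eby.
have [x' [x'a x'x]] := splice eax; have [y' [y'b y'y]] := splice eby.
exists x', y'; split=> //; [by move=> i /x'a|by move=> i /y'b|].
move=> n' n'n ab; split=> [||| i ki].
- exact: leq_trans nk.
- move=> i /andP[n'i ik]; case: (ltnP i n) => [lt_in|le_ni].
    by rewrite x'a// y'b//; apply: ab; rewrite n'i.
  by rewrite x'x// y'y//; apply: xy; rewrite le_ni.
- by rewrite x'x// y'y.
- by rewrite x'x ?y'y ?e// (leq_trans nk (ltnW ki)).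
Qed.

End Paths.

Lemma succ_from_rev (B : bratteli) (w : border B) n k (x y : path_space B) :
  succ_from w n k x y -> succ_from (rev_border w) n k y x.
Proof.
move=> [nk xy s e]; split=> // [i /xy[]//||i /e//]; exact: is_succ_rev.
Qed.

Lemma rev_border_inv (B : bratteli) (w : border B) :
  rev_border (rev_border w) = w.
Proof.
case: w => *; rewrite /rev_border /=.
by congr BOrder; apply: Prop_irrelevance.
Qed.

(** * Two-letter factors of sorted sequences *)

Section Infix.
Variables (T U : eqType).

Lemma infix2_sorted (lt : rel T) (s : seq T) p q :
    transitive lt -> irreflexive lt -> sorted lt s ->
  infix [:: p; q] s <->
  [/\ p \in s, q \in s, lt p q & forall r, r \in s -> lt p r -> ~~ lt r q].
Proof.
move=> lt_trans lt_irr; rewrite sorted_pairwise// => s_lt; split.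
  move=> /infixP[s1 [s2 es]]; move: s_lt; rewrite es /= pairwise_cat /=.
  rewrite !mem_cat !inE !eqxx !orbT /= => /and3P[].
  move=> /allrelP s1p _ /and3P[/andP[pq /allP ps2] /allP qs2 _]; split=> // r.
  rewrite mem_cat !inE => /orP[rs1 pr|/or3P[/eqP->|/eqP->|rs2 _]].
  - have /(lt_trans _ _ _ pr) := s1p r p rs1 (mem_head _ _).
    by rewrite lt_irr.
  - by rewrite lt_irr.
  - by rewrite lt_irr.
  - by apply/negP => /(lt_trans _ _ _ (qs2 r rs2)); rewrite lt_irr.
case=> ps qs pq pqP; case/splitPr: ps qs pqP s_lt => s1 s2 qs pqP s_lt.
move: s_lt; rewrite pairwise_cat /=.
move=> /and3P[/allrelP s1p _ /andP[/allP ps2 s2_lt]].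
move: qs; rewrite mem_cat inE => /or3P[qs1|/eqP qp|qs2].
- have /(lt_trans _ _ _ pq) := s1p q p qs1 (mem_head _ _).
  by rewrite lt_irr.
- by rewrite qp lt_irr in pq.
(* The entry [c] right after [p] must be [q], as otherwise it would lie strictly between [p] and
   [q]. *)
move: {s1p} pqP ps2 s2_lt qs2; case: s2 => [//|c s2] pqP ps2 s2_lt qs2.
move: qs2; rewrite inE => /predU1P[->|qs2].
  by apply/infixP; exists s1, s2.
move: s2_lt => /= /andP[/allP/(_ _ qs2) cq _].
have := pqP c; rewrite cq mem_cat !inE eqxx !orbT ps2 ?mem_head//.
by move=> /(_ isT isT).
Qed.

Lemma infix2_map (f : T -> U) (s : seq T) a b :
  infix [:: a; b] (map f s) <->
  exists p q, [/\ infix [:: p; q] s, f p = a & f q = b].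
Proof.
split=> [/infixP[l [r e]]|[p [q [/infixP[l [r ->]] <- <-]]]]; last first.
  by apply/infixP; exists (map f l), (map f r); rewrite !map_cat.
have : map f (drop (size l) s) = [:: a; b] ++ r.
  by rewrite map_drop e drop_size_cat.
case es : (drop _ _) => [|p [|q s']]//= [fp fq _].
exists p, q; split=> //; apply/infixP; exists (take (size l) s), s'.
by rewrite -[LHS](cat_take_drop (size l)) es.
Qed.

End Infix.

(** * Finite paths as restrictions of infinite ones, and their order *)

Section Restriction.
Variables (B : bratteli) (w : border B) (n m : nat).
Implicit Types (x y z : path_space B) (p q r : edge_seq B n m).

(** Viewing finite paths as restrictions replaces the dependent indices [i + n] by the plain indices
    of an infinite path. *)
Definition restr x : edge_seq B n m := [ffun i : 'I_m.+1 => x (i + n)].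

Lemma restr_path x : is_path (restr x).
Proof. by apply/forallP => i; rewrite !ffunE /= edge_at_path. Qed.

Lemma path_src_restr x : path_src (restr x) = vtx n x.
Proof. by rewrite /path_src ffunE. Qed.

Lemma path_rng_restr x : path_rng (restr x) = rng (x (m + n)).
Proof. by rewrite /path_rng ffunE. Qed.

Lemma restr_surj p : is_path p -> exists x, restr x = p.
Proof.
move=> /forallP pP.
(* The family [b] carries the edges of [p], transported along [i + n = j], and arbitrary edges at
   all other indices. *)
have [b bp] : exists b : forall j, edge B j,
    forall i : 'I_m.+1, b (i + n) = p i.
  have : forall j, exists e : edge B j, forall (i : 'I_m.+1) (ij : i + n = j),
      e = ecast j (edge B j) ij (p i).
    move=> j; case: (pselect (exists i : 'I_m.+1, i + n = j)) => [[i ij]|noi].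
      exists (ecast j (edge B j) ij (p i)) => i' ij'.
      have ii' : i' = i by apply/val_inj/(@addIn n); rewrite ij.
      by rewrite {i'}ii' in ij' *; rewrite (eq_irrelevance ij' ij).
    have [e _] : exists e : edge B j, True.
      elim: j {noi} => [|j [e _]].
        by have [e _] := src_surj (Defs.root B); exists e.
      by have [e' _] := src_surj (rng e); exists e'.
    by exists e => i ij; case: noi; exists i.
  move=> H; exists (fun j => projT1 (cid (H j))) => i.
  by rewrite (projT2 (cid (H (i + n))) i erefl).
pose nxt j (e : edge B j) : edge B j.+1 := xchoose (src_surj (rng e)).
have nxtP j (e : edge B j) : rng e = src (nxt j e).
  by apply/esym/eqP; apply: (xchooseP (src_surj (rng e))).
have [y [yn yP yb]] := minimal_below w b (b n).
(* The path is minimal below level [n], follows [p] up to index [m + n], and then continues along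
   arbitrary outgoing edges. *)
pose fix f j : edge B j := match j with
  | 0 => y 0
  | j'.+1 => if j'.+1 <= m + n then y j'.+1 else nxt j' (f j') end.
have fy j : j <= m + n -> f j = y j by case: j => //= j ->.
have fP j : rng (f j) = src (f j.+1).
  rewrite [f j.+1]/=; case: (ltnP j (m + n)) => [jmn|_]; last exact: nxtP.
  rewrite fy; last exact: ltnW.
  case: (ltnP j n) => [/yP[]//|nj].
  have yb' i : n <= i -> y i = b i.
    by rewrite leq_eqVlt => /predU1P[<-//|/yb].
  rewrite !yb'//; last exact: leqW.
  have jm : j - n < m by rewrite ltn_subLR ?(addnC n).
  have : rng (b (j - n + n)) = src (b (j - n + n).+1).
    by have /eqP := pP (Ordinal jm); rewrite -!bp.
  by rewrite subnK.
exists (PathSpace fP); apply/ffunP => i; rewrite ffunE /= fy; last first.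
  by rewrite leq_add2r -ltnS.
rewrite -bp; move: (leq_addl i n); rewrite leq_eqVlt => /predU1P[|/yb//].
by move: (i + n) => j <-.
Qed.


End Restriction.

Section PathOrder.
Variables (B : bratteli) (w : border B) (n m : nat).
Implicit Types (x y z : path_space B) (p q r : edge_seq B n m).

Lemma path_lt_restrP x y :
  path_lt w (restr n m x) (restr n m y) <->
  exists k, [/\ n <= k <= m + n, olt w (x k) (y k) &
                forall j, k < j <= m + n -> x j = y j].
Proof.
split=> [/existsP[i /andP[]]|[k [/andP[nk km] xy xyk]]].
  rewrite !ffunE => xy /forallP xyi.
  exists (i + n); split=> // [|j /andP[ij jm]].
    by rewrite leq_addl leq_add2r leq_ord.
  have nj : n <= j by rewrite (leq_trans _ (ltnW ij))// leq_addl.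
  have jnm : j - n < m.+1 by rewrite ltnS leq_subLR addnC.
  have := xyi (Ordinal jnm); rewrite !ffunE /= ltn_subRL addnC ij => /eqP.
  by rewrite subnK.
have knm : k - n < m.+1 by rewrite ltnS leq_subLR addnC.
apply/existsP; exists (Ordinal knm); apply/andP; split.
  by rewrite !ffunE /= subnK.
apply/forallP => j; apply/implyP => /= kj; rewrite !ffunE xyk//.
by rewrite leq_add2r leq_ord andbT addnC -ltn_subLR.
Qed.

Lemma path_lt_irr : irreflexive (@path_lt B w n m).
Proof.
by move=> p; apply/negbTE/negP => /existsP[i /andP[+ _]]; rewrite /olt eqxx.
Qed.

Lemma path_lt_trans : transitive (@path_lt B w n m).
Proof.
move=> q p r /existsP[i /andP[pq /forallP pqi]].
move=> /existsP[j /andP[qr /forallP qrj]].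
apply/existsP; case: (ltngtP i j) => ij.
- exists j; have /eqP -> := implyP (pqi j) ij; rewrite qr.
  apply/forallP => k; apply/implyP => jk.
  by rewrite (eqP (implyP (pqi k) (ltn_trans ij jk))) (implyP (qrj k) jk).
- exists i; have /eqP <- := implyP (qrj i) ij; rewrite pq.
  apply/forallP => k; apply/implyP => ik.
  by rewrite (eqP (implyP (pqi k) ik)) (implyP (qrj k) (ltn_trans ij ik)).
- have {}ij : i = j by apply: val_inj.
  rewrite {i}ij in pq pqi *; exists j; rewrite (olt_trans pq qr).
  apply/forallP => k; apply/implyP => jk.
  by rewrite (eqP (implyP (pqi k) jk)) (implyP (qrj k) jk).
Qed.

Lemma path_le_trans : transitive (@Defs.path_le B w n m).
Proof.
move=> q p r /predU1P[->//|pq] /predU1P[<-|qr]; apply/orP; right=> //.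
exact: path_lt_trans qr.
Qed.

(** At the last index where the paths differ, the two edges have the same range, because the next
    edges coincide or because both paths end at [v]. Hence these edges are comparable. *)
Lemma path_lt_total v :
  {in paths_to v &, forall p q, p != q -> path_lt w p q || path_lt w q p}.
Proof.
move=> p q; rewrite !inE => /andP[/restr_surj[] // x <-{p} /eqP xv].
move=> /andP[/restr_surj[] // y <-{q} /eqP yv] xNy.
have [i0 xyi0] : exists i : 'I_m.+1, restr n m x i != restr n m y i.
  apply/existsP; apply: contraNT xNy => /existsPn xy.
  by apply/eqP/ffunP => i; apply/eqP/negPn/xy.
pose P i := restr n m x i != restr n m y i.
case: (@arg_maxnP _ i0 P (@nat_of_ord _) xyi0) => i xyi imax.
have xy j : i + n < j <= m + n -> x j = y j.
  move=> /andP[ij jm].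
  have nj : n <= j by rewrite (leq_trans _ (ltnW ij))// leq_addl.
  have jnm : j - n < m.+1 by rewrite ltnS leq_subLR addnC.
  apply: contrapT => xyj; have := imax (Ordinal jnm); rewrite /P !ffunE /=.
  rewrite subnK// => /(_ (introN eqP xyj)).
  by rewrite /= leqNgt ltn_subRL addnC ij.
have rxy : rng (x (i + n)) = rng (y (i + n)).
  move: (ltn_ord i); rewrite ltnS leq_eqVlt => /predU1P[im|im].
    by move: xv yv; rewrite !path_rng_restr im => -> ->.
  by rewrite !edge_at_path xy// ltnSn -addSn leq_add2r.
have xyin : x (i + n) != y (i + n) by move: xyi; rewrite /P !ffunE.
have im : n <= i + n <= m + n by rewrite leq_addl leq_add2r leq_ord.
have := ole_comparable w (x (i + n)) (y (i + n)).
rewrite rxy eqxx => /orP[xyle|yxle]; apply/orP; [left|right];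
  apply/path_lt_restrP;
  exists (i + n); split=> //; rewrite /olt ?xyin// 1?eq_sym ?xyin// => j /xy.
by [].
Qed.

(** Sorting relies on totality of [path_le] among the paths to [v]; the sorted sequence is strict
    because an enumeration has no repetition. *)
Lemma sort_path_lt v :
  sorted (path_lt w (n := n) (m := m))
    (sort (@Defs.path_le B w n m) (enum (paths_to v))).
Proof.
rewrite sorted_pairwise; last exact: path_lt_trans.
have : pairwise [rel p q | Defs.path_le w p q && (p != q)]
    (sort (@Defs.path_le B w n m) (enum (paths_to v))).
  rewrite pairwise_relI -uniq_pairwise sort_uniq enum_uniq andbT.
  rewrite -sorted_pairwise; last exact: path_le_trans.
  apply: (sort_sorted_in (P := mem (paths_to v))).
    move=> p q pv qv; rewrite /Defs.path_le.
    have [->//|pq] := eqVneq p q.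
    by have /orP[->|->] := path_lt_total pv qv pq; rewrite ?orbT.
  by apply/allP => p; rewrite mem_enum.
by apply: sub_pairwise => p q /= /andP[/orP[/eqP->|//]]; rewrite eqxx.
Qed.

Lemma word_infix2P v a b :
  infix [:: a; b] (word w v) <->
  exists p q : edge_seq B n m, [/\ p \in paths_to v, q \in paths_to v,
    path_lt w p q,
    forall r, r \in paths_to v -> path_lt w p r -> ~~ path_lt w r q &
    path_src p = a /\ path_src q = b].
Proof.
have infixE := infix2_sorted _ _ path_lt_trans path_lt_irr (sort_path_lt v).
rewrite /word infix2_map; split=> [[p [q [/infixE[]]]]|[p [q]]].
  rewrite !mem_sort !mem_enum => pv qv pq pqP pa qb.
  exists p, q; split=> // r rv.
  by apply: pqP; rewrite mem_sort mem_enum.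
case=> pv qv pq pqP [pa qb]; exists p, q; split=> //; apply/infixE.
by split=> [||//|r]; rewrite mem_sort mem_enum//; apply: pqP.
Qed.

End PathOrder.

(** * Two-letter words of the language as consecutive paths *)

Lemma word_succ_from (B : bratteli) (w : border B) n m (x y : path_space B) k :
    succ_from w n k x y -> k = m + n ->
  infix [:: vtx n x; vtx n y] (word w (rng (x (m + n)))).
Proof.
move=> [_ xyk [xy xyP] _] ek; rewrite {k}ek in xyk xy xyP.
apply/word_infix2P; exists (restr n m x), (restr n m y).
rewrite !inE !path_src_restr !restr_path !path_rng_restr -(olt_rng xy) eqxx.
have nm : n <= m + n by apply: leq_addl.
split=> //=.
  apply/path_lt_restrP; exists (m + n); split=> //; first by rewrite nm leqnn.
  by move=> j /andP[mj]; rewrite leqNgt mj.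
(* Below the top index [x] is maximal and [y] minimal, so a path strictly between them would need a
   top edge strictly between [x (m + n)] and its successor. *)
move=> r; rewrite inE => /andP[/restr_surj[] // z <-{r} _].
move=> /path_lt_restrP[i [/andP[ni]]]; rewrite leq_eqVlt.
move=> /predU1P[->|im] xz xzi; last first.
  by move: xz; rewrite maximal_olt//; apply: (xyk _ _).1; rewrite ni.
apply/negP => /path_lt_restrP[j [/andP[nj]]]; rewrite leq_eqVlt.
move=> /predU1P[->|jm] zy zyj; last first.
  by move: zy; rewrite minimal_olt//; apply: (xyk _ _).2; rewrite nj.
by move: (zy); rewrite oltNge ?(olt_rng zy)// xyP.
Qed.

Lemma language2P (B : bratteli) (w : border B) n (a b : vert B n) :
  language w [:: a; b] <->
  exists k x y, [/\ succ_from w n k x y, vtx n x = a & vtx n y = b].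
Proof.
split=> [[m [v /word_infix2P[p [q]]]]|[k [x [y [xy <- <-]]]]]; last first.
  have [nk _ _ _] := xy; exists (k - n), (rng (x (k - n + n))).
  by apply: word_succ_from xy _; rewrite subnK.
rewrite !inE => -[/andP[/restr_surj[] // x <-{p} /eqP xv]].
move=> /andP[/restr_surj[] // y <-{q} /eqP yv].
rewrite !path_src_restr => /path_lt_restrP[k [/andP[nk km] xyk xyj]] between.
move=> [xa yb].
(* A path that follows [x] after [k] also ends at [v]; if [k] is the top index, this follows from
   the comparison of [z] with [x]. *)
have {}between (z : path_space B) : (forall j, k < j -> z j = x j) ->
    path_lt w (restr n m x) (restr n m z) ->
    ~ path_lt w (restr n m z) (restr n m y).
  move=> zx xz; apply/negP/between => //; rewrite inE restr_path /=.
  move: km xv; rewrite !path_rng_restr leq_eqVlt.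
  move=> /predU1P[kE|km] <-; last first.
    by rewrite zx.
  move: xz => /path_lt_restrP[j [/andP[_ +] xz]].
  rewrite leq_eqVlt => /predU1P[jE _|jm /(_ (m + n))].
    by rewrite -jE (olt_rng xz).
  by rewrite jm leqnn => /(_ isT) ->.
have ryx : rng (y k) = rng (x k) by rewrite (olt_rng xyk).
(* Beyond index [m + n] the extension [y] is arbitrary, so its tail is replaced by that of [x]. *)
have [z [zy zx]] : exists z : path_space B,
    (forall i, i < k.+1 -> z i = y i) /\ (forall i, k.+1 <= i -> z i = x i).
  by apply: splice; rewrite /vtx -!edge_at_path.
have zb : vtx n z = b by rewrite /vtx zy.
exists k, x, z; split=> //; split=> //.
- move=> i /andP[ni ik]; rewrite zy ?ltnS ?(ltnW ik)//; split.
    (* Raising a non-maximal edge of [x] below [k] would give a path strictly between the two. *)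
    apply/negPn/negP => /nonmaximal_olt[f xf].
    have [t [ti _ tx]] := replace_edge w (esym (olt_rng xf)).
    apply: (between t) => [j kj||].
    + by rewrite tx// (ltn_trans ik).
    + apply/path_lt_restrP; exists i; rewrite ti ni (leq_trans (ltnW ik) km).
      by split=> // j /andP[ij _]; rewrite tx.
    + apply/path_lt_restrP; exists k; rewrite nk km tx//; split=> // j jk.
      by rewrite tx ?xyj//; case/andP: jk => kj _; apply: ltn_trans kj.
  (* Symmetrically, lowering a non-minimal edge of [z] below [k] would give such a path. *)
  apply/negPn/negP => /nonminimal_olt[f fy].
  have fz : rng f = rng (z i) by rewrite (olt_rng fy) zy// ltnS ltnW.
  have [t [ti _ tz]] := replace_edge w fz.
  apply: (between t) => [j kj||].
  + by rewrite tz ?zx// (ltn_trans ik).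
  + apply/path_lt_restrP; exists k; rewrite nk km tz// zy//; split=> // j.
    by move=> /andP[kj _]; rewrite tz ?zx// (ltn_trans ik).
  + apply/path_lt_restrP; exists i; rewrite ti ni (leq_trans (ltnW ik) km).
    split=> // j /andP[ij jm]; rewrite tz//.
    case: (ltnP j k.+1) => [/zy//|kj]; by rewrite zx// xyj// kj.
- rewrite zy//; split=> // g xg; apply: contraT.
  rewrite -oltNge => [gy|]; last by rewrite -(olt_rng xg) ryx.
  have [t [tk _ tx]] := replace_edge w (esym (olt_rng xg)).
  case: (between t) => //.
    apply/path_lt_restrP; exists k; rewrite tk nk km.
    by split=> // j /andP[/tx].
  apply/path_lt_restrP; exists k; rewrite tk nk km; split=> // j /andP[kj jm].
  by rewrite tx ?xyj// kj.
Qed.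

(** * From a Vershik map to a correspondence *)

Lemma homeomorphism_restrict (T : topologicalType) (phi : T -> T)
    (A C : set T) :
  homeomorphism phi -> phi @` A = C ->
  exists2 f : A -> C, (forall x, set_val (f x) = phi (set_val x)) &
    homeomorphism f.
Proof.
move=> [phi_cont [psi [psi_cont phiK psiK]]] phiA.
have phi_in (x : A) : phi (set_val x) \in C.
  by rewrite -phiA inE; exists (set_val x) => //; apply: set_valP.
have psi_in (y : C) : psi (set_val y) \in A.
  have : (phi @` A) (set_val y) by rewrite phiA; apply: set_valP.
  by case=> x Ax <-; rewrite phiK inE.
exists (fun x => exist (fun y => y \in C) _ (phi_in x)) => //; split.
  (* A subspace carries the initial topology of its inclusion, so continuity into it is checked
     after the inclusion. *)
  apply: continuous_comp_initial => x.
  apply: (@continuous_comp _ _ _ (set_val : A -> T) phi); last exact: phi_cont.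
  exact: initial_continuous.
exists (fun y => exist (fun x => x \in A) _ (psi_in y)); split.
- apply: continuous_comp_initial => y.
  apply: (@continuous_comp _ _ _ (set_val : C -> T) psi); last exact: psi_cont.
  exact: initial_continuous.
- by move=> x; apply: val_inj; apply: phiK.
- by move=> y; apply: val_inj; apply: psiK.
Qed.

Section PerfectCorrespondence.
Variables (B : bratteli) (w : border B) (phi : path_space B -> path_space B).
Hypothesis phi_vershik : vershik_map w phi.
Implicit Types x y M m : path_space B.

Lemma vershik_succ k x y : succ_from w 0 k x y -> phi x = y.
Proof.
move=> xy; have [_ xm s _] := xy; case: phi_vershik => _ _ phiP.
have [||phim phis phie] := phiP x k.
- exact: is_succ_nonmaximal s.
- by move=> i ik; apply: (xm i ik).1.
apply: (succ_from_unique (k := k) _ xy); split=> //.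
by move=> i ik; split; [apply: (xm i ik).1|apply: phim].
Qed.

Lemma vershik_near x N :
  exists N', forall y, agree N' x y -> agree N (phi x) (phi y).
Proof.
case: phi_vershik => -[phi_cont _] _ _.
have /(phi_cont x)/nbhs_pathP[N' N'P] :
    nbhs (phi x) [set y | agree N (phi x) y].
  by apply/nbhs_pathP; exists N.
by exists N'.
Qed.

(* As the maximal paths have empty interior, [M] is a limit of paths [x] that
   are not maximal, and [phi x] is then the successor of [x]. *)
Lemma sigma_related_vershik M : (Xmax w)^° = set0 -> Xmax w M ->
  sigma_related (language_maps w) M (phi M).
Proof.
move=> Xmax0 MM n n0; case: phi_vershik => _ phiX _.
split; first by exists (phi M) => //; rewrite -phiX; exists M.
have [N NP] := vershik_near M n.+1.
have [x Mx xM] : exists2 x, agree (maxn N n.+1) M x & ~ Xmax w x.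
  apply: contrapT => none; suff : (Xmax w)^° M by rewrite Xmax0.
  apply/nbhs_pathP; exists (maxn N n.+1) => x Mx; apply: contrapT => xM.
  by apply: none; exists x.
have [k [y xy]] := succ_from_exists xM.
have nk : n < k.
  apply: leq_trans (succ_from_agree_max xy MM (agree_sym Mx)).
  exact: leq_maxr.
apply/language2P; exists k, x, y; split.
- by apply: succ_from_le xy; rewrite leq0n ltnW.
- by rewrite /vtx Mx// leq_maxr.
- by rewrite -(vershik_succ xy) /vtx -NP//; apply: agree_le Mx; apply: leq_maxl.
Qed.

Lemma sigma_related_unique M m : Xmax w M -> Xmin w m ->
  sigma_related (language_maps w) M m -> phi M = m.
Proof.
move=> MM mm Mm; apply: path_ext => j; have [N NP] := vershik_near M j.+1.
(* This level is positive, close enough to [M] for the continuity of [phi], and deep enough to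
   include the edge [m j]. *)
have n0 : 0 < maxn N j.+1 by rewrite leq_max orbT.
have [_ /language2P[k [x [y [xy xM ym]]]]] := Mm _ n0.
(* As [M] is maximal and [m] minimal, the pair lowered along them is consecutive from level 0, hence
   [phi x' = y']. *)
have [x' [y' [Mx' my' x'y']]] := succ_from_lower xy (esym xM) (esym ym).
rewrite (my' j) ?leq_maxr//.
rewrite -(vershik_succ (x'y' 0 (leq0n _) (fun i _ => conj (MM i) (mm i)))).
by apply: NP => //; apply: agree_le Mx'; apply: leq_maxl.
Qed.

End PerfectCorrespondence.

(** A word at the upper level comes from paths consecutive from there; replacing their lower parts
    by the given maximal and minimal paths keeps them consecutive from level [n]. *)
Lemma language_maps_consistent (B : bratteli) (w : border B) :
  composition_consistent (skeleton_of w) (language_maps w).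
Proof.
move=> n m p q n0 [/restr_surj -/(_ w)[P <-{p}] Pmax] _.
move=> [/restr_surj -/(_ w)[Q <-{q}] Qmin] _.
have {}Pmax i : n <= i < (m + n).+1 -> maximal_edge w (P i).
  rewrite ltnS => /andP[ni im].
  have inm : i - n < m.+1 by rewrite ltnS leq_subLR addnC.
  by apply/max_edgeP; have := Pmax (Ordinal inm); rewrite !ffunE /= subnK.
have {}Qmin i : n <= i < (m + n).+1 -> minimal_edge w (Q i).
  rewrite ltnS => /andP[ni im].
  have inm : i - n < m.+1 by rewrite ltnS leq_subLR addnC.
  by apply/min_edgeP; have := Qmin (Ordinal inm); rewrite !ffunE /= subnK.
rewrite !path_src_restr !path_rng_restr !edge_at_path => -[[m0 m0min m0Q]].
move=> /language2P[k [x [y [xy xP yQ]]]].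
have nmn : n < (m + n).+1 by rewrite ltnS leq_addl.
split.
  (* The minimal path [m0] through the range of [Q] coincides with [Q] down to level [n], so the
     source of [Q] is a minimal vertex. *)
  exists m0 => //; rewrite /vtx.
  rewrite (minimal_unique (w := w) (n := n) (k := (m + n).+1) (y := Q))
    ?leqnn//.
  by move=> i ni; split; [apply: m0min|apply: Qmin].
have [x' [y' [Px' Qy' x'y']]] := succ_from_lower xy (esym xP) (esym yQ).
apply/language2P; exists k, x', y'; rewrite /vtx -Px'// -Qy'//; split=> //.
by apply: x'y' => [|i ni]; [apply: ltnW|split; [apply: Pmax|apply: Qmin]].
Qed.

Lemma perfect_correspondence (B : bratteli) (w : border B) :
  (Xmax w)^° = set0 -> perfect_order w ->
  correspondence (skeleton_of w) (language_maps w).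
Proof.
move=> Xmax0 [phi phiV]; have [phi_homeo phiX _] := phiV.
have related := sigma_related_vershik phiV Xmax0.
have unique := sigma_related_unique phiV.
have phi_max M : Xmax w M -> Xmin w (phi M).
  by move=> MM; rewrite -phiX; exists M.
split.
- move=> n n0; apply/seteqP; split=> [v [u _ []]//|_ [m + <-]] /=.
  rewrite -{1}phiX => -[M MM <-]; exists (vtx n M); first by exists M.
  exact: related.
- exact: language_maps_consistent.
- move=> M; rewrite sk_Xmax_skeleton_of sk_Xmin_skeleton_of => MM.
  exists (phi M); split=> [|m [mm Mm]]; last exact: unique.
  by split; [apply: phi_max|apply: related].
- move=> m; rewrite sk_Xmax_skeleton_of sk_Xmin_skeleton_of => mm.
  move: (mm); rewrite -phiX => -[M MM phiM].
  exists M; split=> [|M' [M'M M'm]].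
    by split=> //; rewrite -phiM; apply: related.
  case: phi_homeo => _ [psi [_ phiK _]]; apply: (can_inj phiK).
  by rewrite (unique M' m).
- have [|f fE f_homeo] := homeomorphism_restrict phi_homeo
    (A := sk_Xmax (skeleton_of w)) (C := sk_Xmin (skeleton_of w)).
    by rewrite sk_Xmax_skeleton_of sk_Xmin_skeleton_of.
  exists f => // M; rewrite fE; apply: related.
  by have := set_valP M; rewrite -sk_Xmax_skeleton_of.
Qed.

(** * From a correspondence to a Vershik map *)

Section CorrespondencePerfect.
Variables (B : bratteli) (w : border B).
Implicit Types x y M m : path_space B.

(** The graph of the future Vershik map, kept as a relation so that the map and its inverse are
    treated alike. *)
Definition vershik_graph x y :=
  [/\ Xmax w x, Xmin w y & sigma_related (language_maps w) x y] \/
  exists k, succ_from w 0 k x y.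

Lemma succ_from_nonmin k x y : succ_from w 0 k x y -> ~ Xmin w y.
Proof. by move=> /succ_from_rev/succ_from_nonmax. Qed.

(* If [x] is maximal, each approximating pair ([x'], [y']) puts the word
   [vtx n x; vtx n y] in the language for small [n], whether [x'] is maximal or
   [y'] is its successor. *)
Lemma vershik_graph_closed x y :
  (forall N, exists x' y',
     [/\ vershik_graph x' y', agree N x x' & agree N y y']) ->
  vershik_graph x y.
Proof.
move=> lim; case: (pselect (Xmax w x)) => [xM|xNM].
  left; have ym : Xmin w y.
    move=> i; have [x' [y' [[[_ y'm _]|[k x'y']] xx' yy']]] := lim i.+1.
      by rewrite yy'.
    have ik := succ_from_agree_max x'y' xM (agree_sym xx').
    by rewrite yy'//; case: x'y' => _ /(_ i ik)[].
  split=> // n n0; split; first by exists y.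
  have [x' [y' [+ xx' yy']]] := lim n.+1.
  rewrite /vtx xx'// yy'//= => -[[_ _ /(_ n n0)[]//]|[k x'y']].
  have nk := succ_from_agree_max x'y' xM (agree_sym xx').
  apply/language2P; exists k, x', y'; split=> //.
  by apply: succ_from_le x'y'; rewrite leq0n ltnW.
have [k [z xz]] := succ_from_exists xNM; right; exists k.
suff <- : z = y by [].
(* Agreement beyond both [j] and [k] forces [x'] to be non-maximal and determines its successor at
   [j]. *)
apply: path_ext => j; have kj : k < (maxn j k).+1 by rewrite ltnS leq_maxr.
have [x' [y' [[[x'M _ _]|[k' x'y']] xx' yy']]] := lim (maxn j k).+1.
  by have := succ_from_agree_max xz x'M xx'; rewrite leqNgt kj.
rewrite yy' ?ltnS ?leq_maxl//.
by rewrite (succ_from_agree xz x'y' kj xx')// ltnS leq_maxl.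
Qed.

(** A path with a successor is not maximal and one with a predecessor is not minimal, so the two
    alternatives of [vershik_graph] never mix. With (2) and (3) the relation is total and
    single-valued in both directions. *)
Lemma correspondence_perfect :
  correspondence (skeleton_of w) (language_maps w) -> perfect_order w.
Proof.
case=> _ _; rewrite sk_Xmax_skeleton_of sk_Xmin_skeleton_of => maxP minP _.
have fun_r x y y' : vershik_graph x y -> vershik_graph x y' -> y = y'.
  move=> [[xM ym xy]|[k xy]] [[x'M y'm xy']|[k' xy']].
  - have [m [_ mP]] := maxP x xM.
    by rewrite -(mP y) ?(mP y').
  - by case: (succ_from_nonmax xy').
  - by case: (succ_from_nonmax xy).
  - exact: succ_from_unique xy xy'.
have fun_l y x x' : vershik_graph x y -> vershik_graph x' y -> x = x'.
  move=> [[xM ym xy]|[k xy]] [[x'M y'm xy']|[k' xy']].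
  - have [m [_ mP]] := minP y ym.
    by rewrite -(mP x) ?(mP x').
  - by case: (succ_from_nonmin xy').
  - by case: (succ_from_nonmin xy).
  - exact: succ_from_unique (succ_from_rev xy) (succ_from_rev xy').
have /choice[phi phiP] x : exists y, vershik_graph x y.
  case: (pselect (Xmax w x)) => [xM|/succ_from_exists[k [y xy]]].
    by have [y [[ym xy] _]] := maxP x xM; exists y; left.
  by exists y; right; exists k.
have /choice[psi psiP] y : exists x, vershik_graph x y.
  case: (pselect (Xmin w y)) => [ym|yNm].
    by have [x [[xM xy] _]] := minP y ym; exists x; left.
  (* A predecessor is a successor for the reversed order. *)
  have [k [x /succ_from_rev]] := succ_from_exists (w := rev_border w) yNm.
  by rewrite rev_border_inv => xy; exists x; right; exists k.
have phiK : cancel phi psi by move=> x; apply: fun_l (psiP _) (phiP x).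
have psiK : cancel psi phi by move=> y; apply: fun_r (phiP _) (psiP y).
exists phi; split.
- split; first exact: closed_graph_continuous phiP fun_r vershik_graph_closed.
  exists psi; split=> //.
  (* The transposed relation is closed as well, which gives continuity of the inverse. *)
  apply: (closed_graph_continuous (R := fun y x => vershik_graph x y)) => //.
  move=> y x lim.
  apply: vershik_graph_closed => N; have [y' [x' [? ? ?]]] := lim N.
  by exists x', y'.
- apply/seteqP; split=> [_ [x xM <-]|y ym].
    by case: (phiP x) => [[]//|[k /succ_from_nonmax]].
  exists (psi y); last exact: psiK.
  by case: (psiP y) => [[]//|[k /succ_from_nonmin]].
- move=> x k xk xkmax; case: (phiP x) => [[xM]|[k' x'y']].
    by have := xM k; rewrite (negPf xk).
  (* Both are the index of the first non-maximal edge of [x]. *)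
  have k'k : k' = k.
    move: x'y' => [_ x'y' /is_succ_nonmaximal xk' _].
    case: (ltngtP k' k) => // [/xkmax|/x'y'[]]; first by rewrite (negPf xk').
    by rewrite (negPf xk).
  rewrite {k'}k'k in x'y'; case: x'y' => _ xy s e; split=> // i ik.
  exact: (xy i ik).2.
Qed.

End CorrespondencePerfect.


Theorem theorem3p17 (B : bratteli) (w : border B)
    (isolB : no_isolated_point B) (aperB : aperiodic B)
    (regB : regular_diagram B)
    (wtw : well_telescoped w)
    (cardX : Xmax w #= Xmin w) :
  perfect_order w <-> correspondence (skeleton_of w) (language_maps w).
Proof.
split; last exact: correspondence_perfect.
by apply: perfect_correspondence; case: (regB w).
Qed.
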